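(* Let $\nu\in\mathrm{O}(\Lambda)$ have cycle shape $2^{12}$, with vacuum anomaly $\rho_\nu=3/4$. There is no $h\in\pi_\nu(\Lambda\otimes\mathbb Q)$ such that the set of lattice points $\{\beta\in\pi_\nu(\Lambda):\langle\beta-h,\beta-h\rangle/2=1-\rho_\nu\}$, with edges defined by $\langle\beta_i-\beta_j,\beta_i-\beta_j\rangle/2=2(1-\rho_\nu)$ (no edge), $3(1-\rho_\nu)$ (single edge), $4(1-\rho_\nu)$ (double edge), forms a diagram containing $A_2^3$. In particular, there is no generalised deep hole $g$ of $V_\Lambda$ projecting to $\nu$ with $\Phi(g)=A_2^3$.
   Context: $\Lambda$ is the Leech lattice, $\mathrm O(\Lambda)\cong\mathrm{Co}_0$, $V_\Lambda$ its lattice VOA (strongly rational, i.e.\ rational, $C_2$-cofinite, self-contragredient, CFT-type; holomorphic; central charge 24). $\pi_\nu=\frac1{|\nu|}\sum_i\nu^i$ is the projection onto the $\nu$-fixed subspace of $\Lambda\otimes\mathbb R$. Cycle shape $\prod t^{b_t}$ of $\nu$: characteristic polynomial $\prod(x^t-1)^{b_t}$; vacuum anomaly $\rho_\nu=\frac1{24}\sum b_t(t-1/t)$. Automorphisms of $V_\Lambda$ are $\phi_\eta(\nu)\sigma_h$ ($\phi_\eta(\nu)$ a lift of $\nu$, $\sigma_h=e^{2\pi ih_0}$), projecting to $\nu$. For $g$ of order $n$, $V_\Lambda(g^i)$ is the unique irreducible $g^i$-twisted module; type $0$ means its conformal weight is in $\frac1n\mathbb Z$; positivity: irreducible $V_\Lambda^g$-modules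 other than $V_\Lambda^g$ have positive conformal weight; $V_\Lambda^{\mathrm{orb}(g)}=\bigoplus_{i\in\mathbb Z_n}W^{(i,0)}$ is the cyclic orbifold construction ($W^{(i,0)}$ the $g$-invariants of $V_\Lambda(g^i)$). With $c_n(d)$ given by $\sum_{d\mid n}c_n(d)\gcd(t,d)=n/t$ for all $t\mid n$, $g$ (order $n>1$, type 0, positivity) is a generalised deep hole if $\dim (V_\Lambda^{\mathrm{orb}(g)})_1=24+\sum_{d\mid n}c_n(d)\dim(V_\Lambda^{g^d})_1$ and $\operatorname{rk}(V_\Lambda^{\mathrm{orb}(g)})_1=\operatorname{rk}(V_\Lambda^g)_1$. $\Phi(g)$ is the Dynkin diagram (Cartan matrix $2\langle\alpha_i,\alpha_j\rangle/\langle\alpha_i,\alpha_i\rangle$) of the set of weights of the Cartan subalgebra $(V_\Lambda^g)_1\cong\pi_\nu(\Lambda\otimes\mathbb C)$ of $(V_\Lambda^{\mathrm{orb}(g)})_1$ acting on $V_\Lambda(g)_1$. *)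

(* Defs.v *)
From HB Require Import structures.
From mathcomp Require Import all_boot all_order all_algebra.
Set Implicit Arguments. Unset Strict Implicit. Unset Printing Implicit Defensive.
Import Order.TTheory GRing.Theory Num.Theory.
Local Open Scope ring_scope.

(* Lattices of rank 24 are given in coordinates: a lattice point is a row
   vector in 'rV[rat]_24 with integer coordinates w.r.t. a fixed Z-basis,
   and the bilinear form is  <x,y> = x G y^T  for the Gram matrix G. *)

Definition intvec (n : nat) (v : 'rV[rat]_n) : Prop :=
  forall i, v 0 i \is a Num.int.

Definition intmx (m n : nat) (A : 'M[rat]_(m, n)) : Prop :=
  forall i j, A i j \is a Num.int.

Definition form (n : nat) (G : 'M[rat]_n) (x y : 'rV[rat]_n) : rat :=
  (x *m G *m y^T) 0 0.

(* G is a Gram matrix of the Leech lattice: an even unimodular positive-definite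
   lattice of rank 24 without roots (vectors of norm 2).  By Conway's theorem
   this characterises the Leech lattice up to isometry. *)
Definition is_Leech_gram (G : 'M[rat]_24) : Prop :=
  intmx G /\ G^T = G /\ (forall i, (G i i / 2%:R) \is a Num.int) /\
  \det G = 1 /\
  (forall x : 'rV[rat]_24, x != 0 -> 0 < form G x x) /\
  (forall x : 'rV[rat]_24, intvec x -> form G x x != 2%:R).

(* N (acting on row vectors x |-> x *m N) is an element of O(Lambda):
   it preserves the lattice and the form. *)
Definition in_O_lattice (G N : 'M[rat]_24) : Prop :=
  intmx N /\ N *m G *m N^T = G.

Definition is_order (N : 'M[rat]_24) (n : nat) : Prop :=
  (0 < n)%N /\ N ^+ n = 1 /\ (forall m : nat, (0 < m < n)%N -> N ^+ m != 1).

Definition cycle_shape_2_12 (N : 'M[rat]_24) : Prop :=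
  char_poly N = ('X ^+ 2 - 1) ^+ 12.

Definition pi_nu (N : 'M[rat]_24) (n : nat) (x : 'rV[rat]_24) : 'rV[rat]_24 :=
  (n%:R)^-1 *: \sum_(i < n) (x *m N ^+ i).

(* vacuum anomaly of cycle shape 2^12: (1/24) * 12 * (2 - 1/2) = 3/4 *)
Definition rho_2_12 : rat := 3%:R / 4%:R.

Definition in_pi_lattice (N : 'M[rat]_24) (n : nat) (b : 'rV[rat]_24) : Prop :=
  exists x, intvec x /\ b = pi_nu N n x.

Definition in_pi_rational (N : 'M[rat]_24) (n : nat) (h : 'rV[rat]_24) : Prop :=
  exists x, h = pi_nu N n x.

Definition vertex (G N : 'M[rat]_24) (n : nat) (rho : rat) (h b : 'rV[rat]_24) : Prop :=
  in_pi_lattice N n b /\ form G (b - h) (b - h) / 2%:R = 1 - rho.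

Definition hdist (G : 'M[rat]_24) (a b : 'rV[rat]_24) : rat :=
  form G (a - b) (a - b) / 2%:R.

(* The diagram contains A_2^3: there are six vertices b_(k,0), b_(k,1) (k<3)
   such that the induced subdiagram on them is A_2 + A_2 + A_2: the two
   vertices of each component are joined by a single edge (distance 3(1-rho))
   and vertices in different components are not joined (distance 2(1-rho)). *)
Definition contains_A2_cubed (G N : 'M[rat]_24) (n : nat) (rho : rat)
    (h : 'rV[rat]_24) : Prop :=
  exists b : 'I_3 -> 'I_2 -> 'rV[rat]_24,
    (forall k l, vertex G N n rho h (b k l)) /\
    (forall k, hdist G (b k 0) (b k 1) = 3%:R * (1 - rho)) /\
    (forall k k' l l', k != k' -> hdist G (b k l) (b k' l') = 2%:R * (1 - rho)).

(* Main.v *)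
Require Import Defs.
From mathcomp Require Import all_boot all_order all_algebra ring zify.
Import GRing.Theory Num.Theory.
Import Defs.
Set Implicit Arguments. Unset Strict Implicit. Unset Printing Implicit Defensive.
Local Open Scope ring_scope.

(* The characteristic polynomial (x^2 - 1)^12 gives (nu^2 - 1)^12 = 0 by Cayley-Hamilton,
   and a unipotent matrix of finite order is the identity in characteristic 0,
   so nu is an involution and its order n is at most 2.  For an isometry of
   order n, n <pi x, pi y> = <x + x nu + ... + x nu^(n-1), y> is an integer.
   In an A_2 + A_2 configuration take b in one component and b', b'' in the
   other: the half squared distances 1/2, 1/2, 3/4 force
   <b - b', b - b''> = 1/4, and n/4 is not an integer. *)

Section Unipotent.
Variables (R : numDomainType) (m : nat).
Implicit Types M P : 'M[R]_m.

(* Multiply the binomial expansion of (M + 1)^(n+1) = 1 by M^j: what survives is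
   M^j + (n + 1) M^(j+1) = M^j. *)
Lemma nilpotent_index_drop M n j :
  (M + 1) ^+ n.+1 = 1 -> M ^+ j.+2 = 0 -> M ^+ j.+1 = 0.
Proof.
rewrite exprD1n => expansion Mj2.
have higher i : M ^+ j * M ^+ i.+2 = 0.
  by rewrite -exprD addnC !addSn -!addnS exprD Mj2 mulr0.
have : M ^+ j * \sum_(i < n.+2) M ^+ i *+ 'C(n.+1, i) = M ^+ j.
  by rewrite expansion mulr1.
rewrite mulr_sumr 2!big_ord_recl big1 => [|i _]; last by rewrite mulrnAr higher mul0rn.
rewrite /= expr0 mulr1 bin1 addr0 mulrnAr -exprSr -[RHS]addr0 => /addrI Mj1n.
apply/matrixP => a b; move/matrixP/(_ a b): Mj1n.
by rewrite mulmxnE !mxE => /eqP; rewrite mulrn_eq0 => /eqP.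
Qed.

Lemma unipotent_root_of_unity P n k :
  (0 < n)%N -> P ^+ n = 1 -> (P - 1) ^+ k = 0 -> P = 1.
Proof.
case: n => [//|n] _ Pn nilM.
have Pn' : (P - 1 + 1) ^+ n.+1 = 1 by rewrite subrK.
suff M1 : (P - 1) ^+ 1 = 0 by apply/eqP; rewrite -subr_eq0 -[P - 1]expr1 M1.
elim: k nilM => [|[|k] IHk] nilM //; first by rewrite exprS nilM mulr0.
by apply: IHk; apply: nilpotent_index_drop Pn' nilM.
Qed.

End Unipotent.

Lemma expr2_eq1_of_char_poly (R : numDomainType) m (N : 'M[R]_m.+1) k n :
  char_poly N = ('X ^+ 2 - 1) ^+ k -> (0 < n)%N -> N ^+ n = 1 -> N ^+ 2 = 1.
Proof.
move=> chiN n_gt0 Nn; apply: (unipotent_root_of_unity n_gt0 (k := k)).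
  by rewrite -exprM mulnC exprM Nn expr1n.
have := Cayley_Hamilton N.
by rewrite chiN rmorphXn rmorphB rmorph1 rmorphXn [X in X ^+ 2](horner_mx_X N).
Qed.

Lemma is_order_leq (N : 'M[rat]_24) n k :
  is_order N n -> (0 < k)%N -> N ^+ k = 1 -> (n <= k)%N.
Proof.
move=> [_ [_ minimal]] k_gt0 Nk; rewrite leqNgt; apply/negP => k_lt_n.
by move: (minimal k); rewrite k_gt0 k_lt_n Nk eqxx => /(_ isT).
Qed.

Lemma intmx_mxOver m n (A : 'M[rat]_(m, n)) : intmx A -> A \is a mxOver Num.int.
Proof. by move=> intA; apply/mxOverP. Qed.

Lemma intvec_mxOver n (v : 'rV[rat]_n) : intvec v -> v \is a mxOver Num.int.
Proof. by move=> intv; apply/mxOverP => i j; rewrite ord1. Qed.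

Lemma intvecB n (u v : 'rV[rat]_n) : intvec u -> intvec v -> intvec (u - v).
Proof. by move=> intu intv i; rewrite !mxE rpredB. Qed.

Lemma mxOver_int_expr m (N : 'M[rat]_m) i :
  N \is a mxOver Num.int -> N ^+ i \is a mxOver Num.int.
Proof.
move=> intN; elim: i => [|i IHi]; first by rewrite expr0 mxOver_scalar.
by rewrite exprSr -mulmxE mxOverM.
Qed.

Section Form.
Variables (m : nat) (G : 'M[rat]_m).

Lemma form_int u v :
  G \is a mxOver Num.int -> u \is a mxOver Num.int -> v \is a mxOver Num.int ->
  form G u v \is a Num.int.
Proof.
move=> intG intu intv; suff /mxOverP uGv_int : u *m G *m v^T \is a mxOver Num.int.
  exact: uGv_int.
by rewrite !mxOverM //; apply/mxOverP => i j; rewrite mxE (mxOverP intv).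
Qed.

Lemma formZ a b u v : form G (a *: u) (b *: v) = a * b * form G u v.
Proof. by rewrite /form linearZ -!scalemxAl -scalemxAr !mxE mulrA. Qed.

Lemma form_suml I (r : seq I) (P : pred I) (u : I -> 'rV[rat]_m) v :
  form G (\sum_(i <- r | P i) u i) v = \sum_(i <- r | P i) form G (u i) v.
Proof. by rewrite /form !mulmx_suml summxE. Qed.

Lemma form_sumr I (r : seq I) (P : pred I) u (v : I -> 'rV[rat]_m) :
  form G u (\sum_(i <- r | P i) v i) = \sum_(i <- r | P i) form G u (v i).
Proof. by rewrite /form linear_sum mulmx_sumr summxE. Qed.

Lemma formC u v : G^T = G -> form G u v = form G v u.
Proof.
move=> symG; rewrite /form.
have -> : (u *m G *m v^T) 0 0 = (u *m G *m v^T)^T 0 0 by rewrite [RHS]mxE.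
by rewrite !trmx_mul trmxK symG mulmxA.
Qed.

Lemma formBB u v :
  form G (u - v) (u - v) = form G u u - form G u v - form G v u + form G v v.
Proof. by rewrite /form (linearB trmx) /= !mulmxBl !mulmxBr !mxE; ring. Qed.

End Form.

Lemma form_polarization (G : 'M[rat]_24) u v w : G^T = G ->
  form G (u - v) (u - w) = hdist G u v + hdist G u w - hdist G v w.
Proof.
move=> symG; rewrite /hdist; have -> : v - w = (u - w) - (u - v) by rewrite opprB [RHS]addrC addrA subrK.
rewrite formBB (formC (u - w) (u - v) symG).
by field.
Qed.

Definition orbit_sum (R : pzRingType) m (N : 'M[R]_m) n (x : 'rV[R]_m) :=
  \sum_(i < n) x *m N ^+ i.

Lemma orbit_sum_mulmx (R : pzRingType) m (N : 'M[R]_m) n x :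
  N ^+ n = 1 -> orbit_sum N n x *m N = orbit_sum N n x.
Proof.
case: n => [|n] Nn; first by rewrite /orbit_sum !big_ord0 mul0mx.
have shift : \sum_(i < n.+2) x *m N ^+ i = x + orbit_sum N n.+1 x *m N.
  rewrite big_ord_recl expr0 mulmx1 mulmx_suml; congr (_ + _).
  by apply: eq_bigr => i _; rewrite -mulmxA mulmxE -exprSr.
by apply: (addrI x); rewrite -shift big_ord_recr /= Nn mulmx1 addrC.
Qed.

Section Isometry.
Variables (m n : nat) (G N : 'M[rat]_m).
Hypotheses (isoN : N *m G *m N^T = G) (Nn : N ^+ n = 1).

Lemma form_mulmx u v : form G (u *m N) (v *m N) = form G u v.
Proof. by rewrite /form trmx_mul mulmxA -(mulmxA u N) -(mulmxA u) isoN. Qed.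

Lemma form_mulmx_expr j u v : form G (u *m N ^+ j) (v *m N ^+ j) = form G u v.
Proof.
elim: j => [|j IHj]; first by rewrite expr0 !mulmx1.
by rewrite exprSr -!mulmxE !mulmxA form_mulmx.
Qed.

Lemma orbit_sum_mulmx_expr j x : orbit_sum N n x *m N ^+ j = orbit_sum N n x.
Proof.
elim: j => [|j IHj]; first by rewrite expr0 mulmx1.
by rewrite exprSr -mulmxE mulmxA IHj orbit_sum_mulmx.
Qed.

Lemma form_orbit_sum x y :
  form G (orbit_sum N n x) (orbit_sum N n y) = n%:R * form G (orbit_sum N n x) y.
Proof.
rewrite form_sumr; under eq_bigr => i _ do
  rewrite -[orbit_sum N n x](orbit_sum_mulmx_expr i) form_mulmx_expr.
by rewrite sumr_const card_ord mulr_natl.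
Qed.

End Isometry.

Lemma pi_nuB (N : 'M[rat]_24) n x y : pi_nu N n x - pi_nu N n y = pi_nu N n (x - y).
Proof.
rewrite /pi_nu -scalerBr -sumrB; congr (_ *: _).
by apply: eq_bigr => i _; rewrite mulmxBl.
Qed.

Lemma scaled_form_pi_nu_int (G N : 'M[rat]_24) n x y :
  N *m G *m N^T = G -> N ^+ n = 1 -> (0 < n)%N ->
  G \is a mxOver Num.int -> N \is a mxOver Num.int ->
  x \is a mxOver Num.int -> y \is a mxOver Num.int ->
  n%:R * form G (pi_nu N n x) (pi_nu N n y) \is a Num.int.
Proof.
move=> isoN Nn n_gt0 intG intN intx inty.
have n_neq0 : n%:R != 0 :> rat by rewrite pnatr_eq0 -lt0n.
rewrite /pi_nu -!/(orbit_sum N n _) formZ form_orbit_sum // mulrA mulrA.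
rewrite [_ * _^-1]mulrC -!mulrA mulKf // mulVKf //.
rewrite /orbit_sum form_suml; apply: rpred_sum => i _.
by apply: form_int; rewrite // mxOverM // mxOver_int_expr.
Qed.

Lemma natr_div4_notin_int n : (0 < n < 4)%N -> (n%:R / 4%:R : rat) \isn't a Num.int.
Proof.
move=> n_bounds; apply/negP => /intrP [z n4z].
have : n%:~R = (4 * z)%:~R :> rat by rewrite intrM -n4z mulrC divfK.
by move/intr_inj; lia.
Qed.

Theorem mainTheorem13 (G N : 'M[rat]_24) (n : nat) :
  is_Leech_gram G ->
  in_O_lattice G N ->
  is_order N n ->
  cycle_shape_2_12 N ->
  ~ exists h : 'rV[rat]_24,
      in_pi_rational N n h /\ contains_A2_cubed G N n rho_2_12 h.
Proof.
move=> [intG [symG _]] [intN isoN] ordN shape [h [_ [b [vert [edge nonedge]]]]].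
have [n_gt0 [Nn _]] := ordN.
have n_le2 : (n <= 2)%N.
  by apply: (is_order_leq ordN) => //; apply: expr2_eq1_of_char_poly shape n_gt0 Nn.
have [xp [intp bp]] := (vert 0 0).1.
have [xq [intq bq]] := (vert 1 0).1.
have [xr [intr br]] := (vert 1 1).1.
have := scaled_form_pi_nu_int isoN Nn n_gt0 (intmx_mxOver intG) (intmx_mxOver intN)
  (intvec_mxOver (intvecB intp intq)) (intvec_mxOver (intvecB intp intr)).
rewrite -!pi_nuB -bp -bq -br form_polarization // (nonedge 0 1 0 0) //.
rewrite (nonedge 0 1 0 1) // edge /rho_2_12.
have -> : 2%:R * (1 - 3%:R / 4%:R) + 2%:R * (1 - 3%:R / 4%:R) - 3%:R * (1 - 3%:R / 4%:R)
    = 4%:R^-1 :> rat by field.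
by apply/negP; rewrite natr_div4_notin_int // n_gt0 (leq_ltn_trans n_le2).
Qed.
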